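(* Let $(X,\mathcal{B},\eta)$ be a finite and complete measure space, $-\infty<\alpha<\beta<+\infty$, $\mathcal{U}_{\mathrm{ad}}=\{u\in L^\infty(X):\alpha\le u(x)\le\beta\text{ a.e. in }X\}$, $J:\mathcal{U}_{\mathrm{ad}}\to\mathbb{R}$, and $\bar u\in\mathcal{U}_{\mathrm{ad}}$. Assume: (H1) $J$ can be extended to an $L^\infty(X)$-neighborhood $\mathcal{A}$ of $\mathcal{U}_{\mathrm{ad}}$ and is twice continuously Fréchet differentiable with respect to $L^\infty(X)$ in this neighborhood; moreover $J'(\bar u)(u-\bar u)\ge0$ for all $u\in\mathcal{U}_{\mathrm{ad}}$. (H2) The second derivative $J''(\bar u):L^\infty(X)^2\to\mathbb{R}$ can be extended continuously to $L^q(X)^2$ for some $q\in[1,3/2)$; in particular there is $C>0$ such that $|J''(\bar u)(v_1,v_2)|\le C\|v_1\|_{L^q(X)}\|v_2\|_{L^q(X)}$ for all $v_1,v_2\in L^q(X)$. (H3) For each $\varepsilon>0$ there is $\delta_\varepsilon>0$ such that $|[J''(u_\theta)-J''(\bar u)](u-\bar u)^2|\le\varepsilon\|u-\bar u\|_{L^1(X)}^2$ for all $u\in\mathcal{U}_{\mathrm{ad}}\cap B^1_{\delta_\varepsilon}(\bar u)$, $u_\theta=\bar u+\theta(u-\bar u)$ and any $0\le\theta\le1$. (H4) There is $\bar\psi\in L^1(X)$ such that $J'(\bar u)v=\int_X\bar\psi\,v\,\mathrm{d}\eta$ for all $v\in L^\infty(X)$. (H5) There is a constant $K>0$ such that $\eta(\{x\in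 X:|\bar\psi(x)|\le\varepsilon\})\le K\varepsilon$ for all $\varepsilon>0$. Let $\kappa=(4(\beta-\alpha)K)^{-1}$. Further assume that there exist $\tau>0$ and $\kappa'<2\kappa$ such that $$J''(\bar u)v^2\ge-\kappa'\|v\|_{L^1(X)}^2\quad\forall v\in C^\tau_{\bar u}.$$ Then there exist $\nu>0$ and $\delta>0$ such that $$J(\bar u)+\nu\|u-\bar u\|_{L^1(X)}^2\le J(u)\quad\forall u\in\mathcal{U}_{\mathrm{ad}}\cap B^1_\delta(\bar u).$$
   Context: $B^1_r(v)$ is the open ball of radius $r$ around $v$ with respect to the $L^1(X)$-norm. $J''(u)v^2$ means $J''(u)(v,v)$; for $v\in L^2(X)$, $J''(\bar u)v^2$ is understood via the continuous extension of $J''(\bar u)$ to $L^q(X)^2$. For $\tau>0$ the cone of critical directions is $$C^\tau_{\bar u}=\{v\in L^2(X): v(x)=0\text{ if }|\bar\psi(x)|>\tau,\ v(x)\ge0\text{ if }\bar u(x)=\alpha,\ v(x)\le0\text{ if }\bar u(x)=\beta,\text{ for a.a. }x\in X\}.$$ *)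

(* Defs.v *)
From mathcomp Require Import all_boot all_order all_algebra.
From mathcomp Require Import all_classical all_reals all_analysis.
Import Order.TTheory GRing.Theory Num.Theory.
Import numFieldNormedType.Exports.

Set Implicit Arguments.
Unset Strict Implicit.
Unset Printing Implicit Defensive.

Local Open Scope classical_set_scope.
Local Open Scope ring_scope.

(* The library has no normed-module structure on the Lp spaces: an element of
   Lp is given by a representative ([LfunType]), which is an [lmodType], and the
   Lp norm is then a seminorm whose kernel is a.e. equality.  Frechet calculus
   is therefore written over an lmodule with a seminorm [N].  Derivatives being
   bounded for [N], a functional that is differentiable on an [N]-open set does
   not separate points of that set which are at [N]-distance zero, so that it
   descends to the quotient. *)
Section frechet.
Context {R : realType} {V : lmodType R} (N : V -> R).

Definition seminorm_open (A : set V) : Prop :=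
  forall u, A u -> exists2 r : R, 0 < r & forall w, N (w - u) < r -> A w.

Definition bounded_form (L : {scalar V}) : Prop :=
  exists C : R, forall v, `|L v| <= C * N v.

Definition bounded_biform (B : {biscalar V}) : Prop :=
  exists2 C : R, 0 < C & forall v w, `|B v w| <= C * N v * N w.

Definition frechet_diff (J : V -> R) (u : V) (L : {scalar V}) : Prop :=
  bounded_form L /\
  forall e : R, 0 < e -> exists2 d : R, 0 < d &
    forall h, N h < d -> `|J (u + h) - J u - L h| <= e * N h.

(* [J1] is differentiable at [u] as a map into the dual space, the dual norm
   being spelled out; its derivative [h |-> B h _] is seen as a bilinear form. *)
Definition frechet_diff_dual (J1 : V -> {scalar V}) (u : V)
    (B : {biscalar V}) : Prop :=
  bounded_biform B /\
  forall e : R, 0 < e -> exists2 d : R, 0 < d &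
    forall h, N h < d ->
    forall v, `|J1 (u + h) v - J1 u v - B h v| <= e * N h * N v.

Definition biform_continuous_on (A : set V) (J2 : V -> {biscalar V}) : Prop :=
  forall u, A u -> forall e : R, 0 < e -> exists2 d : R, 0 < d &
    forall w, A w -> N (w - u) < d ->
    forall h k, `|J2 w h k - J2 u h k| <= e * N h * N k.

Definition twice_continuously_frechet_diff (A : set V) (J : V -> R)
    (J1 : V -> {scalar V}) (J2 : V -> {biscalar V}) : Prop :=
  [/\ forall u, A u -> frechet_diff J u (J1 u),
      forall u, A u -> frechet_diff_dual J1 u (J2 u)
    & biform_continuous_on A J2].

End frechet.

Notation Linfty eta := (LfunType eta (leey 1%E)).
Notation L1 eta := (LfunType eta (lexx 1%E)).
Notation L2 eta := (LfunType eta (lee1n 2)).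

Section Lp.
Context {d : measure_display} {X : measurableType d} {R : realType}.
Variable eta : {finite_measure set X -> \bar R}.

Definition Lpnorm (p : \bar R) (f : X -> R) : R :=
  fine ('N[eta]_p[EFin \o f])%E.

Definition Lfun_seminorm (p : \bar R) (p1 : (1 <= p)%E)
  (f : LfunType eta p1) : R := Lpnorm p f.

Lemma finite_measure_setT_fin : eta [set: X] \is a fin_num.
Proof. exact: fin_num_measure. Qed.

Definition Lincl (p q : \bar R) (p1 : (1 <= p)%E) (q1 : (1 <= q)%E)
    (pq : (p <= q)%E) (f : LfunType eta q1) : LfunType eta p1 :=
  Lfun_Sub p1 (Lfun_subset p1 q1 finite_measure_setT_fin pq (LfunP f)).

Lemma lee_fin_lt32 (q : R) : q < 3 / 2 -> (q%:E <= 2%:R%:E)%E.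
Proof.
move=> q32; rewrite lee_fin; apply/ltW/(lt_le_trans q32).
by rewrite ler_pdivrMr// -natrM ler_nat.
Qed.

Definition Linfty_Lq (q : R) (q1 : (1 <= q%:E)%E) : Linfty eta -> LfunType eta q1 :=
  Lincl q1 (leey q%:E).

Definition L2_Lq (q : R) (q1 : (1 <= q%:E)%E) (q32 : q < 3 / 2) :
    L2 eta -> LfunType eta q1 :=
  Lincl q1 (lee_fin_lt32 q32).

Definition Uad (alpha beta : R) : set (Linfty eta) :=
  [set u : Linfty eta | \forall x \ae eta, alpha <= u x <= beta].

Definition critical_cone (alpha beta tau : R) (ubar : Linfty eta) (psi : L1 eta) :
    set (L2 eta) :=
  [set v : L2 eta | \forall x \ae eta,
    [/\ tau < `|psi x| -> v x = 0,
        ubar x = alpha -> 0 <= v x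
      & ubar x = beta -> v x <= 0]].

End Lp.

Arguments Lpnorm {d X R} eta p%_ereal_scope f%_function_scope.
Arguments Uad {d X R} eta alpha beta.
Arguments Lfun_seminorm {d X R} eta {p} p1 f.

(* Main.v *)
(* Put v = u - ubar, and split v = w + z with w carried by {|psi| <= tau}, so
   that w lies in the critical cone.  The variational inequality makes the
   first-order term equal to the integral of |psi v|, which is at least
   kappa |w|_1^2 + tau |z|_1.  With kappa' < 2 kappa this absorbs J''(w,w)/2,
   leaving a multiple of |w|_1^2 + |z|_1, which dominates |v|_1^2 near 0.  The
   remaining second-order terms are bounded by |w|_q |z|_q and |z|_q^2, and
   |v|_q is at most a constant times |v|_1^(1/q) because |v| <= beta - alpha;
   since 1/q > 2/3, they are negligible against |w|_1^2 + |z|_1. *)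

Require Import Defs.
From mathcomp Require Import all_boot all_order all_algebra.
From mathcomp Require Import all_classical all_reals all_analysis.
From mathcomp Require Import measurable_realfun ess_sup_inf.
From mathcomp Require Import ring lra.
Import Order.TTheory GRing.Theory Num.Theory.
Import numFieldNormedType.Exports.

Set Implicit Arguments.
Unset Strict Implicit.
Unset Printing Implicit Defensive.

Local Open Scope classical_set_scope.
Local Open Scope ring_scope.

(** * Second-order lower bounds in one real variable *)

Lemma is_derive_of_eps (R : realType) (f : R -> R) (t l : R) :
  (forall e, 0 < e -> exists2 d, 0 < d &
    forall h, `|h| < d -> `|f (t + h) - f t - h * l| <= e * `|h|) ->
  is_derive t 1 f l.
Proof.
move=> ftl.
have cvgl : h^-1 *: (f (h *: (1 : R) + t) - f t) @[h --> 0^'] --> l.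
  apply/cvgrPdist_le => e e0; have [d d0 dP] := ftl e e0.
  near=> h.
  have h0 : h != 0 by near: h; exact: nbhs_dnbhs_neq.
  have hd : `|h| < d by near: h; exact: dnbhs0_lt.
  rewrite [h *: _]mulr1 (addrC h) -(ler_pM2r (x := `|h|)) ?normr_gt0// -normrM.
  rewrite -normrN -mulNr opprB mulrBl [_ *: _ * h]mulrAC mulVf// mul1r (mulrC l).
  exact: dP.
by apply: DeriveDef; [apply/cvg_ex; exists l | exact: cvg_lim cvgl].
Unshelve. all: by end_near. Qed.

(** The mean value theorem is used twice. Applied to [f'], it gives [f' 0 + m * t <= f' t]; hence
    [f] minus the quadratic [f' 0 * t + m / 2 * t ^+ 2] has a nonnegative derivative, and its values
    at 0 and 1 are compared. *)
Lemma second_order_lower_bound (R : realType) (f f' f'' : R -> R) (m : R) :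
  (forall t : R, 0 <= t <= 1 -> is_derive t 1 f (f' t)) ->
  (forall t : R, 0 <= t <= 1 -> is_derive t 1 f' (f'' t)) ->
  (forall t : R, 0 <= t <= 1 -> m <= f'' t) ->
  f 0 + f' 0 + m / 2 <= f 1.
Proof.
move=> df df' mf''.
have cont (g g' : R -> R) (b : R) : b <= 1 ->
    (forall t : R, 0 <= t <= 1 -> is_derive t 1 g (g' t)) ->
    {within `[0, b], continuous g}.
  move=> b1 dg; apply/derivable_within_continuous => t.
  rewrite in_itv/= => /andP[t0 tb].
  by have [] : is_derive t 1 g (g' t) by apply: dg; rewrite t0 (le_trans tb).
have f'_ge (t : R) : 0 <= t <= 1 -> f' 0 + m * t <= f' t.
  move=> /andP[t0 t1].
  have [|s] := @MVT_segment R f' f'' 0 t t0 _ (cont _ _ _ t1 df').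
    move=> s; rewrite in_itv/= => /andP[s0 st]; apply: df'.
    by rewrite (ltW s0) (le_trans (ltW st)).
  rewrite in_itv/= subr0 => /andP[s0 st] f'E.
  rewrite addrC -lerBrDr f'E ler_wpM2r// mf''// s0; exact: le_trans st t1.
pose g (t : R) := f t - (f' 0 * t + m / 2 * (t * t)).
pose g' (t : R) := f' t - (f' 0 + m * t).
have dg (t : R) : 0 <= t <= 1 -> is_derive t 1 g (g' t).
  move=> /df dft; rewrite /g /g'.
  apply: is_derive_eq; rewrite /GRing.scale/=; lra.
have [|s] := @MVT_segment R g g' 0 1 ler01 _ (cont _ _ _ (lexx _) dg).
  by move=> s; rewrite in_itv/= => /andP[s0 s1]; apply: dg; rewrite !ltW.
rewrite in_itv/= => /f'_ge; rewrite /g /g' !(mulr0, mulr1, subr0, addr0).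
lra.
Qed.

(** * Frechet derivatives along a segment *)

Section frechet_line.
Context {R : realType} {V : lmodType R} (N : V -> R).
Hypothesis N_ge0 : forall v, 0 <= N v.
Hypothesis NZ : forall (t : R) v, N (t *: v) = `|t| * N v.

Lemma frechet_diff_is_derive (J : V -> R) (u v : V) (t : R) (L : {scalar V}) :
  frechet_diff N J (u + t *: v) L ->
  is_derive t 1 (fun s => J (u + s *: v)) (L v).
Proof.
move=> [_ JL]; apply: is_derive_of_eps => e e0.
(* [N v] may vanish, so tolerance and radius are scaled by [N v + 1]. *)
have Nv1 : 0 < N v + 1 by rewrite ltr_wpDl.
have [d d0 dP] := JL (e / (N v + 1)) (divr_gt0 e0 Nv1).
exists (d / (N v + 1)); first exact: divr_gt0.
move=> h hd; have Nhd : N (h *: v) < d.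
  rewrite NZ; move: hd; rewrite ltr_pdivlMr//; apply: le_lt_trans.
  by rewrite ler_wpM2l// lerDl.
rewrite scalerDl addrA.
have := dP _ Nhd; rewrite linearZ/= NZ => /le_trans; apply.
rewrite -mulrA ler_wpM2l ?(ltW e0)// mulrCA ler_piMr//.
by rewrite mulrC ler_pdivrMr// mul1r lerDl.
Qed.

Lemma frechet_diff_dual_is_derive (J1 : V -> {scalar V}) (u v : V) (t : R)
    (B : {biscalar V}) :
  frechet_diff_dual N J1 (u + t *: v) B ->
  is_derive t 1 (fun s => J1 (u + s *: v) v) (B v v).
Proof.
move=> [_ JB]; apply: is_derive_of_eps => e e0.
have Nv1 : 0 < N v + 1 by rewrite ltr_wpDl.
(* The square is there because [v] is both the direction of the increment and the argument of the
   functional, each costing a factor [N v]. *)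
have [d d0 dP] := JB (e / (N v + 1) ^+ 2) (divr_gt0 e0 (exprn_gt0 2 Nv1)).
exists (d / (N v + 1)); first exact: divr_gt0.
move=> h hd; have Nhd : N (h *: v) < d.
  rewrite NZ; move: hd; rewrite ltr_pdivlMr//; apply: le_lt_trans.
  by rewrite ler_wpM2l// lerDl.
rewrite scalerDl addrA.
have := dP _ Nhd v; rewrite linearZl_LR/= NZ => /le_trans; apply.
rewrite [leLHS](_ : _ = e * `|h| * (N v / (N v + 1)) ^+ 2); last first.
  by field; rewrite gt_eqF.
rewrite ler_piMr ?mulr_ge0 ?(ltW e0)// exprn_ile1 ?divr_ge0 ?(ltW Nv1)//.
by rewrite ler_pdivrMr// mul1r lerDl.
Qed.

Lemma frechet_taylor_lower_bound (A : set V) (J : V -> R)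
    (J1 : V -> {scalar V}) (J2 : V -> {biscalar V}) (u v : V) (m : R) :
  twice_continuously_frechet_diff N A J J1 J2 ->
  (forall t : R, 0 <= t <= 1 -> A (u + t *: v)) ->
  (forall t : R, 0 <= t <= 1 -> m <= J2 (u + t *: v) v v) ->
  J u + J1 u v + m / 2 <= J (u + v).
Proof.
move=> [dJ dJ1 _] Auv mJ2.
have := @second_order_lower_bound R (fun t => J (u + t *: v))
  (fun t => J1 (u + t *: v) v) (fun t => J2 (u + t *: v) v v) m.
rewrite !scale0r addr0 scale1r; apply=> // t t01.
  exact/frechet_diff_is_derive/dJ/Auv.
exact/frechet_diff_dual_is_derive/dJ1/Auv.
Qed.

End frechet_line.

(* AM-GM in the form [(a b)^(2/3) = (a^2 b b)^(1/3) <= (a^2 + 2 b) / 3]: any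
   exponent above [2/3] leaves a spare positive power of [a b]. *)
Lemma powR_mul_small (R : realType) (s e : R) : 2 / 3 < s -> 0 < e ->
  exists2 d : R, 0 < d & forall a b, 0 <= a < d -> 0 <= b < d ->
    a `^ s * b `^ s <= e * (a ^+ 2 + b).
Proof.
move=> s23 e0; pose r := s - 2 / 3.
have r0 : 0 < r by rewrite subr_gt0.
(* Since [a < 1], [a * b <= b < e ^ (1 / r)], so the spare power [(a * b) ^ r] is at most [e]. *)
exists (Num.min 1 (e `^ r^-1)); first by rewrite lt_min ltr01 powR_gt0.
move=> a b; rewrite !lt_min => /and3P[a0 a1 ae] /and3P[b0 b1 be].
have ab0 : 0 <= a * b by exact: mulr_ge0.
rewrite -powRM//.
have -> : (a * b) `^ s = (a * b) `^ r * (a * b) `^ (2 / 3).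
  have [->|ab_neq0] := eqVneq (a * b) 0.
    by rewrite !powR0 ?mul0r ?gt_eqF//; lra.
  by rewrite -powRD ?ab_neq0 ?implybT// /r subrK.
apply: ler_pM; rewrite ?powR_ge0//.
  have -> : e = (e `^ r^-1) `^ r by rewrite -powRrM mulVf ?gt_eqF// powRr1 ?ltW.
  apply: ge0_ler_powR; rewrite ?nnegrE ?powR_ge0 ?(ltW r0)//.
  by apply: le_trans (ltW be); rewrite ler_piMl// ltW.
set y := _ `^ _.
have y3 : y ^+ 3 = (a * b) ^+ 2.
  by rewrite -powR_mulrn ?powR_ge0// -powRrM divfK// powR_mulrn.
have y0 : 0 <= y by exact: powR_ge0.
(* After cubing, with [p = a ^+ 2], the claim is [p * b ^+ 2 <= (p + b) ^+ 3], whose left side is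
   dominated by one term of the binomial expansion. *)
rewrite -(ler_pXn2r (n := 3)) ?nnegrE ?addr_ge0 ?sqr_ge0// y3.
have p0 : 0 <= a ^+ 2 by exact: sqr_ge0.
rewrite exprMn; move: (a ^+ 2) p0 => p p0.
have : 0 <= p * b ^+ 2 by rewrite mulr_ge0 ?sqr_ge0.
have : 0 <= p ^+ 2 * b by rewrite mulr_ge0 ?sqr_ge0.
have : 0 <= p ^+ 3 by rewrite exprn_ge0.
have : 0 <= b ^+ 3 by rewrite exprn_ge0.
lra.
Qed.

(** * Norms and integrals on a finite measure space *)

Section Lp_finite_measure.
Context {d : measure_display} {X : measurableType d} {R : realType}.
Variable eta : {finite_measure set X -> \bar R}.
Implicit Types f g : X -> R.

Lemma LpnormZ (p : \bar R) (p1 : (1 <= p)%E) (t : R) (f : LfunType eta p1) :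
  Lfun_seminorm eta p1 (t *: f) = `|t| * Lfun_seminorm eta p1 f.
Proof.
apply: EFin_inj.
by rewrite EFinM /Lfun_seminorm /Lpnorm !finite_norm_fine -LnormZ.
Qed.

Lemma Lpnorm_ge0 (p : \bar R) f : 0 <= Lpnorm eta p f.
Proof. by rewrite fine_ge0// Lnorm_ge0. Qed.

Lemma Lpnorm1E f : Lpnorm eta 1 f = \int[eta]_x `|f x|.
Proof. by rewrite /Lpnorm Lnorm1. Qed.

Lemma ae_le_integrable f g : measurable_fun setT f ->
  eta.-integrable setT (EFin \o g) -> (\forall x \ae eta, `|f x| <= `|g x|) ->
  eta.-integrable setT (EFin \o f).
Proof.
move=> mf /integrableP[mg ig] fg; apply/integrableP; split.
  exact/measurable_EFinP.
apply: le_lt_trans ig; apply: ae_ge0_le_integral => //=.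
- by apply/measurable_EFinP; exact: measurableT_comp.
- by apply/measurable_EFinP; apply: measurableT_comp => //; exact/measurable_EFinP.
- by apply: filterS fg => x fgx _; rewrite lee_fin.
Qed.

Lemma ae_le_Rintegral f g :
  eta.-integrable setT (EFin \o f) -> eta.-integrable setT (EFin \o g) ->
  (\forall x \ae eta, f x <= g x) -> \int[eta]_x f x <= \int[eta]_x g x.
Proof.
move=> fi gi fg; rewrite -subr_ge0 -RintegralB//.
have mgf : measurable_fun setT (fun x => g x - f x).
  by apply: measurable_funB; apply/measurable_EFinP; [case/integrableP: gi |
    case/integrableP: fi].
(* Passing to the absolute value, equal a.e. to [g - f], makes nonnegativity hold at every point. *)
rewrite (_ : Rintegral _ _ _ = \int[eta]_x `|g x - f x|); last first.
  congr fine; apply: ae_eq_integral => //.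
  - exact/measurable_EFinP.
  - exact/measurable_EFinP/measurableT_comp.
  - by apply: filterS fg => x fgx _; rewrite /= ger0_norm// subr_ge0.
by apply: Rintegral_ge0 => x _; exact: normr_ge0.
Qed.

Lemma bounded_Lfun_infty f (M : R) : measurable_fun setT f ->
  (\forall x \ae eta, `|f x| <= M) -> f \in Lfun eta +oo%E.
Proof.
move=> mf fM; rewrite inE; apply/andP; split; rewrite inE//= /finite_norm.
rewrite unlock; case: ifPn => // _; apply: le_lt_trans (ltry M).
by apply/ess_supP; apply: filterS fM.
Qed.

Lemma Linfty_ae_bounded (v : Linfty eta) :
  exists2 M, 0 <= M & \forall x \ae eta, `|v x| <= M.
Proof.
(* The norm at infinity is an essential supremum only if the space has positive measure; otherwise
   the whole space is null and any bound holds a.e. *)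
have [eta0|eta0] := ltP 0%E (eta setT).
  have : finite_norm eta +oo%E v by exact: Lfunction_finite.
  rewrite /finite_norm unlock eta0.
  move=> /(ess_supr_bounded (f := fun x => `|v x|))[M vM].
  exists (Num.max 0 M); first by rewrite le_max lexx.
  by apply: filterS vM => x; rewrite le_max => ->; rewrite orbT.
exists 0 => //; exists setT; split => //.
by apply/eqP; rewrite eq_le eta0 measure_ge0.
Qed.

Lemma integrable_mul_Linfty (psi : L1 eta) (v : Linfty eta) :
  eta.-integrable setT (EFin \o (fun x => psi x * v x)).
Proof.
have [M M0 vM] := Linfty_ae_bounded v.
apply: (@ae_le_integrable _ (fun x => M * psi x)).
- by apply: measurable_funM.
- have /Lfun1_integrable psii := LfunP psi.
  have := integrableZl measurableT M psii.
  by [].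
- by apply: filterS vM => x vxM; rewrite !normrM (ger0_norm M0) mulrC ler_wpM2r.
Qed.

Lemma integrable_Linfty (v : Linfty eta) :
  eta.-integrable setT (EFin \o v).
Proof.
apply/Lfun1_integrable.
exact: (Lfun_subset (lexx 1%E) (leey 1%E) (finite_measure_setT_fin eta)
  (leey 1%E) (LfunP v)).
Qed.

(** Integrate [|f| ^ q <= M ^ (q - 1) * |f|] and take the [q]-th root. *)
Lemma Lpnorm_interpolation (q M : R) f : 1 <= q -> 0 <= M ->
  eta.-integrable setT (EFin \o f) -> (\forall x \ae eta, `|f x| <= M) ->
  Lpnorm eta q%:E f <= (M `^ (q - 1)) `^ q^-1 * Lpnorm eta 1 f `^ q^-1.
Proof.
move=> q1 M0 fi fM; have q0 : 0 < q := lt_le_trans ltr01 q1.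
have mf : measurable_fun setT f by apply/measurable_EFinP; case/integrableP: fi.
have afi : eta.-integrable setT (EFin \o (fun x => `|f x|)).
  exact: integrable_norm.
have I : (\int[eta]_x (`|f x| `^ q)%:E <= (M `^ (q - 1) * Lpnorm eta 1 f)%:E)%E.
  rewrite Lpnorm1E EFinM /Rintegral fineK ?integrable_fin_num//.
  rewrite -integralZl//; apply: ae_ge0_le_integral => //=.
  - apply/measurable_EFinP/(@measurableT_comp _ _ _ _ _ _ (@powR R ^~ q)) => //.
    exact: measurableT_comp.
  - by move=> x _; rewrite -EFinM lee_fin mulr_ge0// powR_ge0.
  - by apply: emeasurable_funM => //; apply/measurable_EFinP; exact: measurableT_comp.
  - apply: filterS fM => x fxM _; rewrite -EFinM lee_fin -mulr_powRB1// mulrC.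
    by rewrite ler_wpM2r// ge0_ler_powR// subr_ge0.
move: (Lpnorm eta 1 f) (Lpnorm_ge0 1 f) I => n n0.
rewrite /Lpnorm unlock -[Y in fine Y]/((\int[eta]_x (`|f x| `^ q)%:E) `^ q^-1)%E.
have : (0 <= \int[eta]_x (`|f x| `^ q)%:E)%E.
  by apply: integral_ge0 => x _; rewrite lee_fin powR_ge0.
case: (\int[eta]_x _)%E => [r| |]//=; rewrite !lee_fin => r0 rI.
rewrite -powRM ?powR_ge0// ge0_ler_powR ?nnegrE ?invr_ge0 ?(ltW q0)//.
by rewrite mulr_ge0 ?powR_ge0.
Qed.

Lemma Lfun_infty_mul_indic (v : Linfty eta) (S : set X) : measurable S ->
  (fun x => v x * \1_S x) \in Lfun eta +oo%E.
Proof.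
move=> mS; have [M M0 vM] := Linfty_ae_bounded v.
apply: (@bounded_Lfun_infty _ M).
  by apply: measurable_funM => //; exact: measurable_indic.
apply: filterS vM => x; apply: le_trans; rewrite normrM ler_piMr// indicE.
by case: (x \in S); rewrite ?normr1 ?normr0.
Qed.

Definition Linfty_restrict (S : set X) (mS : measurable S) (v : Linfty eta) :
  Linfty eta := Lfun_Sub (leey 1%E) (Lfun_infty_mul_indic v mS).

(* The lower bound comes from [e |v| <= |psi v| + e M 1_{|psi| <= e}]
   with the optimal [e = |v|_1 / (2 M K)]. *)
Lemma integral_mul_quadratic_growth (psi : L1 eta) (v : Linfty eta) (K M : R) :
  0 < K -> 0 < M ->
  (forall e : R, 0 < e ->
    (eta [set x | `|psi x|%R <= e]%R <= (K * e)%:E)%E) ->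
  (\forall x \ae eta, `|v x| <= M) ->
  (4 * M * K)^-1 * Lpnorm eta 1 v ^+ 2 <= \int[eta]_x `|psi x * v x|.
Proof.
move=> K0 M0 psiK vM; set n := Lpnorm _ _ _; set I := Rintegral _ _ _.
have I0 : 0 <= I by apply: Rintegral_ge0 => x _; exact: normr_ge0.
have n0 : 0 <= n by exact: Lpnorm_ge0.
have pvi := integrable_norm (integrable_mul_Linfty psi v).
have avi := integrable_norm (integrable_Linfty v).
have growth e : 0 < e -> e * n <= I + e * M * (K * e).
  move=> e0; pose S := [set x | `|psi x| <= e].
  have mS : measurable S.
    rewrite -[S]setTI.
    have : measurable_fun setT (fun x => `|psi x|) by exact: measurableT_comp.
    move=> /(_ measurableT `]-oo, e]%classic (measurable_itv _)).
    by congr (measurable (_ `&` _)); apply/seteqP; split => x /=; rewrite in_itv.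
  have Si : eta.-integrable setT (EFin \o (\1_S : X -> R)).
    by apply: integrable_indic.
  have SZi : eta.-integrable setT (EFin \o (fun x => e * M * \1_S x)).
    exact: (integrableZl measurableT (e * M) Si).
  have vZi : eta.-integrable setT (EFin \o (fun x => e * `|v x|)).
    exact: (integrableZl measurableT e avi).
  apply: (@le_trans _ _ (\int[eta]_x (`|psi x * v x| + e * M * \1_S x))).
    rewrite /n Lpnorm1E -RintegralZl//; apply: ae_le_Rintegral => //.
      exact: (integrableD measurableT pvi SZi).
    apply: filterS vM => x vxM; rewrite indicE normrM.
    have [xS|xS] := boolP (x \in S); rewrite ?mulr1 ?mulr0 ?addr0.
      by rewrite ler_wpDl ?mulr_ge0// ler_wpM2l// ltW.
    rewrite ler_wpM2r// ltW// ltNge; apply/negP => psie.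
    by move/negP: xS; apply; rewrite inE.
  rewrite RintegralD// lerD2l RintegralZl// ler_wpM2l//.
    by rewrite mulr_ge0 ?ltW.
  rewrite /Rintegral integral_indic// setIT -lee_fin fineK ?fin_num_measure//.
  exact: psiK.
(* The optimal [e] is proportional to [n], and [growth] needs it positive. *)
have [->|n_neq0] := eqVneq n 0; first by rewrite expr0n mulr0.
have n_gt0 : 0 < n by rewrite lt_neqAle eq_sym n_neq0.
have := growth (n / (2 * M * K)); rewrite divr_gt0 ?mulr_gt0// => /(_ isT).
rewrite -lerBlDr; apply: le_trans; rewrite le_eqVlt; apply/orP; left.
by apply/eqP; field; rewrite !gt_eqF.
Qed.

Lemma Linfty_restrict_split (S : set X) (mS : measurable S) (v : Linfty eta) :
  v = Linfty_restrict (measurableC mS) v + Linfty_restrict mS v.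
Proof.
apply/LfuneqP => x; rewrite -[RHS]/(v x * \1_(~` S) x + v x * \1_S x).
rewrite !indicE in_setC -mulrDr.
by case: (x \in S); rewrite ?add0r ?addr0 mulr1.
Qed.

(** At each point one of the two pieces of [v] vanishes, so absolute values add exactly, without the
    loss of a triangle inequality. *)
Lemma Rintegral_norm_split (S : set X) (mS : measurable S) (psi : L1 eta)
    (v : Linfty eta) :
  \int[eta]_x `|psi x * v x| =
  \int[eta]_x `|psi x * Linfty_restrict (measurableC mS) v x| +
  \int[eta]_x `|psi x * Linfty_restrict mS v x|.
Proof.
rewrite -RintegralD//; last 2 first.
- exact/integrable_norm/integrable_mul_Linfty.
- exact/integrable_norm/integrable_mul_Linfty.
apply: eq_Rintegral => x _ /=; rewrite !indicE in_setC.
by case: (x \in S); rewrite ?mulr1 ?mulr0 ?normr0 ?add0r ?addr0.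
Qed.

Lemma Lpnorm1_split (S : set X) (mS : measurable S) (v : Linfty eta) :
  Lpnorm eta 1 v = Lpnorm eta 1 (Linfty_restrict (measurableC mS) v) +
                   Lpnorm eta 1 (Linfty_restrict mS v).
Proof.
rewrite !Lpnorm1E -RintegralD//; last 2 first.
- exact/integrable_norm/integrable_Linfty.
- exact/integrable_norm/integrable_Linfty.
apply: eq_Rintegral => x _ /=; rewrite !indicE in_setC.
by case: (x \in S); rewrite ?mulr1 ?mulr0 ?normr0 ?add0r ?addr0.
Qed.

Lemma Linfty_restrict_ae_bounded (S : set X) (mS : measurable S) (v : Linfty eta)
    (M : R) :
  (\forall x \ae eta, `|v x| <= M) ->
  \forall x \ae eta, `|Linfty_restrict mS v x| <= M.
Proof.
apply: filterS => x /=; apply: le_trans; rewrite normrM ler_piMr// indicE.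
by case: (x \in S); rewrite ?normr1 ?normr0.
Qed.

(* Testing the variational inequality with [u] replaced by [ubar] wherever
   [psi * (u - ubar) >= 0] shows that [psi * (u - ubar)] has no negative part. *)
Lemma variational_inequality_abs (alpha beta : R) (psi : L1 eta)
    (ubar : Linfty eta) :
  Uad eta alpha beta ubar ->
  (forall u, Uad eta alpha beta u ->
    0 <= \int[eta]_x (psi x * (u - ubar) x)) ->
  forall u, Uad eta alpha beta u ->
    \int[eta]_x `|psi x * (u - ubar) x| <= \int[eta]_x (psi x * (u - ubar) x).
Proof.
move=> ubarP VI u uP; set v := u - ubar.
pose S := [set x | psi x * v x < 0].
have mS : measurable S.
  rewrite -[S]setTI.
  have : measurable_fun setT (fun x => psi x * v x) by exact: measurable_funM.
  move=> /(_ measurableT `]-oo, 0[%classic (measurable_itv _)).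
  by congr (measurable (_ `&` _)); apply/seteqP; split => x /=; rewrite in_itv.
pose z := Linfty_restrict mS v.
have uz : Uad eta alpha beta (ubar + z).
  apply: filterS2 ubarP uP => x ubarx ux.
  rewrite -[(ubar + z) x]/(ubar x + (u x - ubar x) * \1_S x) indicE.
  by case: (x \in S); rewrite ?mulr0 ?addr0// mulr1 addrC subrK.
have := VI _ uz; rewrite addrC addKr => z0.
have pzi := integrable_mul_Linfty psi z.
have pvi := integrable_norm (integrable_mul_Linfty psi v).
have pzZi : eta.-integrable setT (EFin \o (fun x => 2 * (psi x * z x))).
  exact: (integrableZl measurableT 2 pzi).
(* A negative number [a] equals [|a| + 2 * a], which covers [S]; off [S], [z] vanishes and the
   product is nonnegative. *)
rewrite (_ : \int[eta]_x (psi x * v x) =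
    \int[eta]_x (`|psi x * v x| + 2 * (psi x * z x))).
  by rewrite RintegralD// RintegralZl// lerDl mulr_ge0.
apply: eq_Rintegral => x _; rewrite -[z x]/(v x * \1_S x) indicE.
have [xS|xS] := boolP (x \in S).
  have pv0 : psi x * v x < 0 by rewrite inE in xS.
  by rewrite ltr0_norm// mulr1; ring.
have pv0 : 0 <= psi x * v x.
  by rewrite leNgt; apply/negP => pv0; move/negP: xS; apply; rewrite inE.
by rewrite ger0_norm// !mulr0 addr0.
Qed.

End Lp_finite_measure.

(** * Local quadratic growth in the [L1] norm *)

Theorem theorem2p4 (d : measure_display) (X : measurableType d) (R : realType)
    (eta : {finite_measure set X -> \bar R})
    (eta_complete : measure_is_complete eta)
    (alpha beta : R) (alpha_lt_beta : alpha < beta)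
    (J : Uad eta alpha beta -> R) (ubar : Uad eta alpha beta)
    (A : set (Linfty eta)) (A_open : seminorm_open (Lfun_seminorm eta (leey 1)) A)
    (Uad_A : Uad eta alpha beta `<=` A)
    (Jext : Linfty eta -> R)
    (Jext_J : forall u : Uad eta alpha beta, Jext (\val u) = J u)
    (J1 : Linfty eta -> {scalar Linfty eta})
    (J2 : Linfty eta -> {biscalar Linfty eta})
    (J_C2 : twice_continuously_frechet_diff
      (Lfun_seminorm eta (leey 1)) A Jext J1 J2)
    (J1_ge0 : forall u : Uad eta alpha beta,
      0 <= J1 (\val ubar) (\val u - \val ubar))
    (q : R) (q1 : (1 <= q%:E)%E) (q32 : q < 3 / 2)
    (B : {biscalar LfunType eta q1})
    (B_bounded : bounded_biform (Lfun_seminorm eta q1) B)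
    (B_J2 : forall v w : Linfty eta,
      B (Linfty_Lq q1 v) (Linfty_Lq q1 w) = J2 (\val ubar) v w)
    (J2_L1_continuity : forall e : R, 0 < e -> exists2 delta : R, 0 < delta &
      forall u : Uad eta alpha beta,
      Lpnorm eta 1 (\val u - \val ubar) < delta ->
      forall theta : R, 0 <= theta <= 1 ->
      let v := \val u - \val ubar in
      let utheta := \val ubar + theta *: v in
      `|J2 utheta v v - J2 (\val ubar) v v| <= e * Lpnorm eta 1 v ^+ 2)
    (psi : L1 eta)
    (J1_psi : forall v : Linfty eta,
      J1 (\val ubar) v = \int[eta]_x (psi x * v x))
    (K : R) (K_gt0 : 0 < K)
    (psi_K : forall e : R, 0 < e ->
      (eta [set x | `|psi x|%R <= e]%R <= (K * e)%:E)%E) :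
  let kappa := (4 * (beta - alpha) * K)^-1 in
  (exists tau : R, exists kappa' : R,
    [/\ 0 < tau, kappa' < 2 * kappa &
      forall v : L2 eta,
      critical_cone alpha beta tau (\val ubar) psi v ->
      - kappa' * Lpnorm eta 1 v ^+ 2 <=
        B (L2_Lq q1 q32 v) (L2_Lq q1 q32 v)]) ->
  exists nu : R, exists delta : R, [/\ 0 < nu, 0 < delta &
    forall u : Uad eta alpha beta,
    Lpnorm eta 1 (\val u - \val ubar) < delta ->
    J ubar + nu * Lpnorm eta 1 (\val u - \val ubar) ^+ 2 <= J u].
Proof.
move=> kappa [tau [kappa' [tau0 kk' coercive]]].
have [C C0 CB] := B_bounded.
pose ub : Linfty eta := \val ubar.
have ubP : Uad eta alpha beta ub by have := valP ubar; rewrite inE.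
have A1 (u : Linfty eta) (uP : Uad eta alpha beta u) :
    exists u' : Uad eta alpha beta, \val u' = u.
  by exists (exist _ u (mem_set uP)).
pose M := beta - alpha; have M0 : 0 < M by rewrite subr_gt0.
pose S := [set x | tau < `|psi x|].
have mS : measurable S.
  rewrite -[S]setTI.
  have : measurable_fun setT (fun x => `|psi x|) by exact: measurableT_comp.
  move=> /(_ measurableT `]tau, +oo[%classic (measurable_itv _)).
  by congr (measurable (_ `&` _)); apply/seteqP; split => x /=;
    rewrite in_itv/= andbT.
(* [r] is the available margin: [kappa - kappa' / 2] is the coefficient of [N1 w ^+ 2] left once
   half of the curvature bound is subtracted, and [tau] is the coefficient of [N1 z]. *)
pose r := Num.min (kappa - kappa' / 2) tau.
have r0 : 0 < r by rewrite lt_min tau0 andbT; lra.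
have q1' : 1 <= q by rewrite -lee_fin.
have q0 : 0 < q := lt_le_trans ltr01 q1'.
have s23 : 2 / 3 < q^-1.
  by rewrite -[_ / _]invrK ltf_pV2 ?posrE ?invr_gt0// invf_div.
(* Continuity constant of [B] times the squared interpolation constant; the tolerance [r / (8 * D)]
   then yields [r / 8] in [B_small]. *)
pose D := C * ((M `^ (q - 1)) `^ q^-1) ^+ 2.
have D0 : 0 < D by rewrite mulr_gt0// exprn_gt0// !powR_gt0.
have e0 : 0 < r / (8 * D) by rewrite divr_gt0// mulr_gt0.
have [d1 d10 small] := powR_mul_small s23 e0.
have r4 : 0 < r / 4 by rewrite divr_gt0.
have [d2 d20 J2cont] := J2_L1_continuity _ r4.
pose N1 (f : Linfty eta) := Lpnorm eta 1 f.
(* The maximum treats both orders of the arguments at once, [B] being bilinear without assumed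
   symmetry. It is used with [g := z] and [f] either [w] or [z]. *)
have B_small (f g : Linfty eta) :
    (\forall x \ae eta, `|f x| <= M) -> (\forall x \ae eta, `|g x| <= M) ->
    N1 f < d1 -> N1 g < d1 ->
    Num.max `|J2 ub f g| `|J2 ub g f| <= r / 8 * (N1 f ^+ 2 + N1 g).
  move=> fM gM fd gd; rewrite -!B_J2.
  have Nq (h : Linfty eta) : (\forall x \ae eta, `|h x| <= M) ->
      Lfun_seminorm eta q1 (Linfty_Lq q1 h) <=
      (M `^ (q - 1)) `^ q^-1 * N1 h `^ q^-1.
    by apply: Lpnorm_interpolation => //; [exact: ltW | exact: integrable_Linfty].
  apply: (@le_trans _ _ (D * (N1 f `^ q^-1 * N1 g `^ q^-1))).
    rewrite ge_max; apply/andP; split; apply: le_trans (CB _ _) _;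
      rewrite /D expr2 -!mulrA (ler_pM2l C0) mulrA mulrACA.
      by apply: ler_pM; rewrite ?Lpnorm_ge0 ?Nq.
    by rewrite [leLHS]mulrC; apply: ler_pM; rewrite ?Lpnorm_ge0 ?Nq.
  rewrite (_ : r / 8 = D * (r / (8 * D))); last by field; rewrite gt_eqF.
  by rewrite -[leRHS]mulrA (ler_pM2l D0); apply: small; rewrite Lpnorm_ge0.
(* Write [a], [b], [n] for the [L1] norms of [w], [z], [v]. The first-order term and half the
   curvature leave [(r - r / 4) * (a ^+ 2 + b)], and the variation of [J2] along the segment costs
   [r / 8 * n ^+ 2]. As [n ^+ 2 <= 2 * (a ^+ 2 + b)], what remains is at least
   [(3 / 8 - 1 / 8) * r * n ^+ 2], whence [r / 4]. The bound 1 in the radius ensures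
   [b ^+ 2 <= b]. *)
exists (r / 4), (Num.min (Num.min 1 d1) d2); split => //.
  by rewrite !lt_min ltr01 d10.
move=> u; rewrite !lt_min => /andP[/andP[n1 nd1] nd2].
pose v : Linfty eta := \val u - ub.
have uP : Uad eta alpha beta (\val u) by have := valP u; rewrite inE.
have vM : \forall x \ae eta, `|v x| <= M.
  apply: filterS2 uP ubP => x /andP[au ub_] /andP[aub ubb].
  rewrite -[v x]/((\val u : Linfty eta) x - ub x) ler_norml /M; apply/andP.
  by split; lra.
pose w := Linfty_restrict (measurableC mS) v.
pose z := Linfty_restrict mS v.
have vE : v = w + z := Linfty_restrict_split mS v.
have nE : N1 v = N1 w + N1 z := Lpnorm1_split mS v.
have a0 : 0 <= N1 w by exact: Lpnorm_ge0.
have b0 : 0 <= N1 z by exact: Lpnorm_ge0.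
have wM : \forall x \ae eta, `|w x| <= M by exact: Linfty_restrict_ae_bounded.
have zM : \forall x \ae eta, `|z x| <= M by exact: Linfty_restrict_ae_bounded.
have wd : N1 w < d1 by apply: le_lt_trans nd1; rewrite -/(N1 v) nE lerDl.
have zd : N1 z < d1 by apply: le_lt_trans nd1; rewrite -/(N1 v) nE lerDr.
have b1 : N1 z < 1 by apply: le_lt_trans n1; rewrite -/(N1 v) nE lerDr.
have first_order : kappa * N1 w ^+ 2 + tau * N1 z <= J1 ub v.
  rewrite J1_psi; apply: le_trans (variational_inequality_abs ubP _ uP).
    rewrite (Rintegral_norm_split mS) lerD//.
      exact: integral_mul_quadratic_growth.
    rewrite /N1 Lpnorm1E -RintegralZl//; last first.
      exact/integrable_norm/integrable_Linfty.
    apply: le_Rintegral => //.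
    - exact: (integrableZl measurableT tau (integrable_norm (integrable_Linfty z))).
    - exact/integrable_norm/integrable_mul_Linfty.
    move=> x _; rewrite [leRHS]normrM -[z x]/(v x * \1_S x) indicE.
    have [xS|xS] := boolP (x \in S); last by rewrite mulr0 normr0 !mulr0.
    by rewrite ler_wpM2r// ltW//; move: xS; rewrite inE.
  by move=> u' /A1[u'' <-]; rewrite -J1_psi.
have w_cone : - kappa' * N1 w ^+ 2 <= J2 ub w w.
  (* The inclusions keep the underlying function, so reaching [Lq] through [L2] or directly gives
     the same element. Cone membership: [w] vanishes on [S], and elsewhere its signs come from
     [alpha <= u <= beta]. *)
  pose w2 : L2 eta := Lincl (lee1n 2) (leey 2%:R%:E) w.
  have -> : J2 ub w w = B (L2_Lq q1 q32 w2) (L2_Lq q1 q32 w2).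
    rewrite -B_J2; suff -> : L2_Lq q1 q32 w2 = Linfty_Lq q1 w by [].
    exact/LfuneqP.
  apply: (coercive w2).
  apply: filterS2 uP ubP => x /andP[au ub_] /andP[aub ubb].
  rewrite -[w2 x]/(((\val u : Linfty eta) x - ub x) * \1_(~` S) x).
  rewrite indicE in_setC.
  have [xS|xS] := boolP (x \in S); rewrite ?mulr0 ?mulr1; first by split.
  split => [px|->|->].
  - by move/negP: xS; case; rewrite inE.
  - by rewrite subr_ge0.
  - by rewrite subr_le0.
(* The two mixed terms cost [r / 8 * (a ^+ 2 + b)] each, and the [z], [z] term at most [r / 4 * b]
   because [b ^+ 2 <= b]. *)
have second_order : - kappa' * N1 w ^+ 2 - r / 2 * (N1 w ^+ 2 + N1 z) <= J2 ub v v.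
  have := B_small _ _ wM zM wd zd; have := B_small _ _ zM zM zd zd.
  rewrite maxxx ge_max ler_norml => /andP[zz _] /andP[].
  rewrite !ler_norml => /andP[wz _] /andP[zw _].
  have b2 : r * N1 z ^+ 2 <= r * N1 z.
    by rewrite (ler_pM2l r0) expr2 ler_piMr// ltW.
  have ra : 0 <= r * N1 w ^+ 2 by rewrite mulr_ge0 ?sqr_ge0 ?(ltW r0).
  have -> : J2 ub v v = J2 ub w w + J2 ub w z + (J2 ub z w + J2 ub z z).
    by rewrite vE linearDl !linearDr.
  lra.
(* The segment from [ub] to [u] stays in the convex set [Uad], hence in [A], and [J2cont] bounds the
   second derivative below uniformly along it. *)
have taylor : J ubar + J1 ub v + (J2 ub v v - r / 4 * N1 v ^+ 2) / 2 <= J u.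
  rewrite -!Jext_J (_ : \val u = ub + v); last by rewrite addrC subrK.
  apply: (frechet_taylor_lower_bound (N := Lfun_seminorm eta (leey 1)) _ _ J_C2).
  - by move=> f; exact: Lpnorm_ge0.
  - exact: LpnormZ.
  - move=> t /andP[t0 t1]; apply: Uad_A.
    apply: filterS2 uP ubP => x /andP[au ub_] /andP[aub ubb].
    rewrite -[(ub + t *: v) x]/(ub x + t * ((\val u : Linfty eta) x - ub x)).
    by apply/andP; split; nra.
  - move=> t t01; have : `|J2 (ub + t *: v) v v - J2 ub v v| <= r / 4 * N1 v ^+ 2.
      exact: J2cont nd2 _ t01.
    by rewrite ler_norml => /andP[+ _]; lra.
rewrite -[Lpnorm _ _ _]/(N1 v).
have rk : r * N1 w ^+ 2 <= (kappa - kappa' / 2) * N1 w ^+ 2.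
  by rewrite ler_wpM2r ?sqr_ge0// ge_min lexx.
have rt : r * N1 z <= tau * N1 z by rewrite ler_wpM2r// ge_min lexx orbT.
have n2 : r * N1 v ^+ 2 <= r * (2 * (N1 w ^+ 2 + N1 z)).
  rewrite (ler_pM2l r0) nE.
  have : N1 z ^+ 2 <= N1 z by rewrite expr2 ler_piMr// ltW.
  have := sqr_ge0 (N1 w - N1 z); lra.
lra.
Qed.
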